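(* In $B^{22}(4)$ one has the exact identity $$m_{9,9,3,1}=\mathrm{Sq}^8(m_{5,5,3,1})+\mathrm{Sq}^1(m_{10,6,4,1}).$$ In particular, $m_{9,9,3,1}$ is hit in $B(4)$.
   Context: $P(4)=\mathbf F_2[x_1,\dots,x_4]$, $|x_i|=1$; the total Steenrod square $\mathrm{Sq}=\sum_r\mathrm{Sq}^r$ is the algebra endomorphism with $\mathrm{Sq}(x_i)=x_i+x_i^2$, and $\mathrm{Sq}^r$ is the component raising degree by $r$. $\Sigma_4$ permutes the variables and $B(4)=P(4)^{\Sigma_4}$. $m_{a,b,c,d}\in B(4)$ is the sum of the distinct monomials in the $\Sigma_4$-orbit of $x_1^ax_2^bx_3^cx_4^d$. An element of $B^d(4)$ is hit in $B(4)$ if it lies in $\sum_{r>0}\mathrm{Sq}^r(B^{d-r}(4))$. *)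

(* Defs.v *)
From HB Require Import structures.
From mathcomp Require Import all_boot all_order all_fingroup all_algebra.
From mathcomp Require Import mpoly.

Set Implicit Arguments.
Unset Strict Implicit.
Unset Printing Implicit Defensive.

Import GRing.Theory.
Local Open Scope ring_scope.

Notation P n := {mpoly 'F_2[n]}.

Definition totalSq (n : nat) (p : P n) : P n :=
  p \mPo [tuple 'X_i + 'X_i ^+ 2 | i < n].

(* pihomog mdeg d p is the degree-d part of p; the sum runs over all degrees
   d that can occur in p, since msize p is 1 + the degree of p. *)
Definition Sq (n r : nat) (p : P n) : P n :=
  \sum_(d < msize p) pihomog mdeg (d + r) (totalSq (pihomog mdeg d p)).

Definition inB (n d : nat) (p : P n) : Prop :=
  p \is symmetric /\ p \is d.-homog.

(* The terms r > d are omitted, as B^{d-r} is then 0 (d - r is truncated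
   on nat, so they must not be included). *)
Definition hit (n d : nat) (p : P n) : Prop :=
  inB d p /\
  exists q : nat -> P n,
    (forall r, (0 < r <= d)%N -> inB (d - r) (q r)) /\
    p = \sum_(1 <= r < d.+1) Sq r (q r).

(* undup: each distinct monomial of the orbit is counted once, rather than
   once per permutation. *)
Definition orbit_sum (n : nat) (e : 'X_{1..n}) : P n :=
  \sum_(f <- undup [seq [multinom e (s i) | i < n] | s : 'S_n]) 'X_[f].

Definition m4 (a b c d : nat) : P 4 := orbit_sum (Multinom [tuple a; b; c; d]).

(* Main.v *)
(** Since [Sq (x ^ a) = x ^ a * (1 + x) ^ a], the total square of a monomial
    [x ^ s] is the sum of the [x ^ t] where every [t_i - s_i] is the index of an
    odd binomial coefficient ['C(s_i, t_i - s_i)], and [Sq^r] keeps those with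
    [|t| = |s| + r].  Both sides of the identity are thus explicit lists of
    exponent sequences, which are compared modulo 2 by computation. *)
Require Import Defs.
From mathcomp Require Import all_boot all_order all_fingroup all_algebra.
From mathcomp Require Import mpoly.

Import GRing.Theory.
Local Open Scope ring_scope.

Lemma mulrn_pchar2 (R : nzSemiRingType) (x : R) k :
  2 \in [pchar R] -> x *+ k = if odd k then x else 0.
Proof.
move=> R2; rewrite -{1}(odd_double_half k) mulrnDr -addnn mulrnDr.
by rewrite (addrr_pchar2 R2) addr0; case: (odd k).
Qed.

Lemma pchar2_mpoly n : 2 \in [pchar P n].
Proof.
rewrite !inE /= -(rmorph_nat (@mpolyC n 'F_2)).
by rewrite (_ : 2%:R = 0 :> 'F_2) ?rmorph0 //; apply/val_inj.
Qed.

Fixpoint totalSq_exps (s : seq nat) : seq (seq nat) :=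
  if s is a :: s' then
    [seq (a + k)%N :: t | k <- [seq k <- index_iota 0 a.+1 | odd 'C(a, k)],
                          t <- totalSq_exps s']
  else [:: [::]].

Lemma totalSq_exps_cons a s : totalSq_exps (a :: s) =
  [seq (a + k)%N :: t | k <- [seq k <- index_iota 0 a.+1 | odd 'C(a, k)],
                        t <- totalSq_exps s].
Proof. by []. Qed.

Lemma size_totalSq_exps s t : t \in totalSq_exps s -> size t = size s.
Proof.
elim: s t => [|a s IHs] t; first by rewrite inE => /eqP->.
by case/allpairsP=> -[k u] [_ /IHs su ->] /=; rewrite su.
Qed.

(** Induction on [s]: the first factor is expanded by the binomial theorem and its even coefficients
    vanish. The values [x] form an arbitrary function on [nat] so that the induction hypothesis
    applies to the shifted family [x \o S]. *)
Lemma prod_totalSq_exps (R : comNzRingType) (x : nat -> R) s :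
    2 \in [pchar R] ->
  \prod_(i < size s) (x i + x i ^+ 2) ^+ nth 0%N s i
    = \sum_(t <- totalSq_exps s) \prod_(i < size s) x i ^+ nth 0%N t i.
Proof.
move=> R2; elim: s x => [|a s IHs] x; first by rewrite big_seq1 !big_ord0.
rewrite totalSq_exps_cons big_allpairs_dep big_filter big_mkcond.
change (size (a :: s)) with (size s).+1; rewrite big_ord_recl.
rewrite [X in _ * X](IHs (x \o S)).
rewrite exprDn mulr_suml big_mkord.
apply: eq_bigr => k _; rewrite (mulrn_pchar2 _ _ _ R2).
case: (odd _); last by rewrite mul0r.
rewrite mulr_sumr; apply: eq_bigr => t _; rewrite big_ord_recl /=.
(* The binomial term is [x ^ (a - k) * (x ^ 2) ^ k], that is [x ^ (a + k)], because [k <= a]. *)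
by rewrite -exprM -exprD mul2n -addnn addnA subnK // -ltnS.
Qed.

Definition mnm_of_seq n (s : seq nat) : 'X_{1..n} :=
  [multinom nth 0%N s i | i < n].

Definition poly_of_exps n (l : seq (seq nat)) : P n :=
  \sum_(s <- l) 'X_[mnm_of_seq n s].

Lemma mdeg_mnm_of_seq n s : size s = n -> mdeg (mnm_of_seq n s) = sumn s.
Proof.
move=> <-; rewrite mdegE sumnE (big_nth 0%N) big_mkord.
by apply: eq_bigr => i _; rewrite mnmE.
Qed.

Lemma totalSq_sum n (I : Type) (l : seq I) (F : I -> P n) :
  totalSq (\sum_(i <- l) F i) = \sum_(i <- l) totalSq (F i).
Proof. by rewrite [LHS]raddf_sum. Qed.

Lemma totalSqX n s : size s = n ->
  totalSq 'X_[mnm_of_seq n s] = poly_of_exps n (totalSq_exps s).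
Proof.
(* The variables are extended to all of [nat]; the default 0 is never read below [n']. *)
move=> <-; set n' := size s; pose x i : P n' := nth 0 [tuple 'X_i | i < n'] i.
have xE (i : 'I_n') : x i = 'X_i by rewrite /x -tnth_nth tnth_mktuple.
rewrite /totalSq comp_mpolyX.
under eq_bigr do rewrite tnth_mktuple mnmE -xE.
rewrite (prod_totalSq_exps _ _ _ (pchar2_mpoly n')); apply: eq_bigr => t _.
by rewrite mpolyXE_id; apply: eq_bigr => i _; rewrite mnmE xE.
Qed.

Lemma homogX n d m : mdeg m = d -> ('X_[m] : P n) \is d.-homog.
Proof. by move=> <-; rewrite dhomogX. Qed.

(** In the sum defining [Sq] only the component of degree [d] survives. The zero polynomial is
    treated apart, as its sum is empty. *)
Lemma Sq_homog n r d (p : P n) : p \is d.-homog ->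
  Sq r p = pihomog mdeg (d + r) (totalSq p).
Proof.
move=> hp; have [->|p0] := eqVneq p 0.
  by rewrite /Sq msize0 big_ord0 /totalSq !raddf0.
have dp : (d < msize p)%N.
  (* A nonzero [p] has only one degree, so [d] is the predecessor of [msize p]. *)
  have /dhomog_msize := hp; rewrite -/(msize p) => hp'.
  rewrite (dhomog_uniq p0 hp hp') prednK // lt0n.
  by rewrite msize_poly_eq0.
rewrite /Sq (bigD1 (Ordinal dp)) //= (pihomog_dE hp) big1 ?addr0 // => e ne_ed.
by rewrite (pihomog_ne0 _ hp) ?[totalSq 0]raddf0 ?raddf0 // eq_sym.
Qed.

Definition Sq_exps r (l : seq (seq nat)) : seq (seq nat) :=
  flatten [seq [seq t <- totalSq_exps s | sumn t == (sumn s + r)%N] | s <- l].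

Lemma Sq_poly_of_exps n r d (l : seq (seq nat)) :
    {in l, forall s, size s = n /\ sumn s = d} ->
  Sq r (poly_of_exps n l) = poly_of_exps n (Sq_exps r l).
Proof.
move=> hl; rewrite (@Sq_homog _ _ d); last first.
  rewrite /poly_of_exps big_seq rpred_sum // => s /hl[sz sd].
  by apply: homogX; rewrite mdeg_mnm_of_seq.
rewrite /poly_of_exps totalSq_sum raddf_sum big_flatten big_map.
apply: eq_big_seq => s /hl[sz sd].
rewrite totalSqX // raddf_sum big_filter.
rewrite [RHS]big_mkcond; apply: eq_big_seq => t /size_totalSq_exps szt.
by rewrite /= pihomogX /= mdeg_mnm_of_seq ?szt // sd.
Qed.

(** Symmetric difference with the singleton of [s]: folded over a list, it keeps the entries of odd
    multiplicity. *)
Definition toggle (s : seq nat) l := if s \in l then rem s l else s :: l.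

Lemma poly_of_exps_toggle n l :
  poly_of_exps n (foldr toggle [::] l) = poly_of_exps n l.
Proof.
rewrite /poly_of_exps; elim: l => //= s l IHl; rewrite big_cons -{}IHl.
rewrite /toggle; case: ifP => [s_l | _]; last by rewrite big_cons.
rewrite (perm_big _ (perm_to_rem s_l)) big_cons addrA.
by rewrite (addrr_pchar2 (pchar2_mpoly n)) add0r.
Qed.

Lemma mem_orbit n (e m : 'X_{1..n}) :
  (m \in undup [seq [multinom e (s i) | i < n] | s : 'S_n]) = perm_eq m e.
Proof.
rewrite mem_undup; apply/imageP/tuple_permP => [[s _ ->] | [s ms]]; exists s => //.
by apply/val_inj/val_inj.
Qed.

Lemma mcoeff_orbit_sum n (e m : 'X_{1..n}) :
  (orbit_sum e)@_m = (perm_eq m e)%:R.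
Proof.
rewrite /orbit_sum raddf_sum /= -mem_orbit.
under eq_bigr do rewrite mcoeffX.
set l := undup _; have /(count_uniq_mem m) <- : uniq l := undup_uniq _.
elim: l => [|f l IHl]; first by rewrite big_nil.
by rewrite big_cons IHl /= natrD.
Qed.

Lemma orbit_sum_sym n (e : 'X_{1..n}) : orbit_sum e \is symmetric.
Proof.
apply/issymP => s; apply/mpolyP => m.
rewrite mcoeff_sym !mcoeff_orbit_sum; congr (nat_of_bool _)%:R.
by apply: permPl; apply/tuple_permP; exists s.
Qed.

Lemma orbit_sum_homog n (e : 'X_{1..n}) : orbit_sum e \is (mdeg e).-homog.
Proof.
rewrite /orbit_sum big_seq rpred_sum // => m; rewrite mem_orbit => me.
by apply: homogX; apply/perm_big.
Qed.

Lemma inB_orbit_sum n d (e : 'X_{1..n}) : mdeg e = d -> inB d (orbit_sum e).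
Proof. by move=> <-; split; [exact: orbit_sum_sym | exact: orbit_sum_homog]. Qed.

(** [permutations] lists each rearrangement once even when [e] has equal entries, so it matches the
    orbit without repetition; it also gives a list fit for evaluation. *)
Lemma orbit_sumE n (e : 'X_{1..n}) :
  orbit_sum e = poly_of_exps n (permutations e).
Proof.
rewrite /poly_of_exps -(big_map (mnm_of_seq n) xpredT (fun m => 'X_[m])).
apply/perm_big; have mnmK (m : 'X_{1..n}) : mnm_of_seq n m = m.
  by apply/mnmP => i; rewrite mnmE -mnm_nth.
have seqK s : size s = n -> mnm_of_seq n s = s :> seq nat.
  move=> sz; apply: (@eq_from_nth _ 0%N) => [|i]; rewrite size_tuple ?sz // => ltin.
  by rewrite -[i]/(nat_of_ord (Ordinal ltin)) -mnm_nth mnmE.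
have sz s : s \in permutations e -> size s = n.
  by rewrite mem_permutations => /perm_size->; rewrite size_tuple.
apply: uniq_perm => [||m]; first exact: undup_uniq.
  rewrite map_inj_in_uniq ?permutations_uniq // => s t /sz ss /sz st eq_st.
  by rewrite -(seqK s) // eq_st seqK.
rewrite mem_orbit -mem_permutations; apply/idP/mapP => [me | [s se ->]].
  by exists (m : seq nat).
by rewrite seqK ?sz.
Qed.

Lemma m4E a b c d : m4 a b c d = poly_of_exps 4 (permutations [:: a; b; c; d]).
Proof. exact: orbit_sumE. Qed.

Lemma inB_m4 a b c d : inB (a + b + c + d) (m4 a b c d).
Proof.
by apply: inB_orbit_sum; rewrite mdegE !big_ord_recl big_ord0 addn0 !addnA.
Qed.

Lemma Sq_m4 r a b c d :
  Sq r (m4 a b c d) = poly_of_exps 4 (Sq_exps r (permutations [:: a; b; c; d])).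
Proof.
rewrite m4E (@Sq_poly_of_exps _ _ (sumn [:: a; b; c; d])) // => s.
by rewrite mem_permutations => /[dup] /perm_size-> /perm_sumn->.
Qed.

Lemma Sq0 n r : Sq r (0 : P n) = 0.
Proof. by rewrite /Sq msize0 big_ord0. Qed.

Lemma m4_9931E :
  m4 9 9 3 1 = Sq 8 (m4 5 5 3 1) + Sq 1 (m4 10 6 4 1).
Proof.
rewrite !Sq_m4 m4E /poly_of_exps -big_cat /=; apply/eqP.
(* In characteristic 2 the identity says that in the concatenation of all the lists every exponent
   sequence occurs an even number of times. *)
rewrite -subr_eq0 (oppr_pchar2 (pchar2_mpoly 4)) -big_cat /=; apply/eqP.
rewrite -/(poly_of_exps 4 _) -poly_of_exps_toggle.
set l := foldr _ _ _; have -> : l = [::] by vm_compute.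
by rewrite /poly_of_exps big_nil.
Qed.

Theorem lemma7p4 :
  [/\ inB 22 (m4 9 9 3 1),
      m4 9 9 3 1 = Sq 8 (m4 5 5 3 1) + Sq 1 (m4 10 6 4 1)
    & hit 22 (m4 9 9 3 1)].
Proof.
split; [exact: inB_m4 | exact: m4_9931E | split; first exact: inB_m4].
(* The degrees fit: 5+5+3+1 = 22-8 and 10+6+4+1 = 22-1, while 0 is homogeneous of every degree. *)
pose q r := if r == 8 then m4 5 5 3 1 else if r == 1%N then m4 10 6 4 1 else 0.
exists q; split=> [r _|].
  rewrite /q; case: eqP => [->|_]; first exact: inB_m4.
  case: eqP => [->|_]; first exact: inB_m4.
  by split; [exact: rpred0 | exact: dhomog0].
(* The term [r = 1] is split off first; among the others only [r = 8] is nonzero. *)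
rewrite m4_9931E big_ltn // addrC; congr (_ + _).
rewrite (bigD1_seq 8) ?mem_index_iota ?iota_uniq //= big1_seq ?addr0 // => r.
rewrite mem_index_iota /q => /and3P[/negPf-> r_gt1 _].
by rewrite gtn_eqF // Sq0.
Qed.
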